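(* Let $H$ be a real Hilbert space, let $f:H\to H$ be monotone and Lipschitz continuous, let $D:H\to H$ be a bounded linear operator, and let $\Omega\subset H$ be a nonempty closed convex set. For $x\in H$ put $K(x):=\Omega-Df(x)$. Then for $x^*\in H$, the inclusion $$0\in f(x^* )+(N_\Omega^{-1}+D)^{-1}(x^* )$$ is equivalent to the quasi-variational inequality $$0\in f(x^* )+N_{K(x^* )}(x^* ).$$
   Context: For a closed convex set $K\subset H$ and $x\in K$, the normal cone is $N_K(x)=\{x^*\in H:\langle x^*,y-x\rangle\le 0\text{ for all }y\in K\}$, and $N_K(x)=\emptyset$ for $x\notin K$. For a set-valued map $\mathcal F$, $\mathcal F^{-1}(y)=\{x: y\in\mathcal F(x)\}$. *)

(* Defs.v *)
From HB Require Import structures.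
From mathcomp Require Import all_boot all_order all_algebra.
From mathcomp Require Import all_classical all_reals all_analysis.

Set Implicit Arguments.
Unset Strict Implicit.
Unset Printing Implicit Defensive.

Import Order.TTheory GRing.Theory Num.Theory.
Import numFieldNormedType.Exports.

Local Open Scope classical_set_scope.
Local Open Scope ring_scope.

(* [{dot H for idfun}] is the type of symmetric positive definite bilinear
   forms on [H]; [inner_norm] makes the norm of [H], hence also its complete
   uniform structure and its topology, the one induced by the inner product. *)
HB.mixin Record CompleteNormedModule_isHilbert (R : realType) H
    of CompleteNormedModule R H := {
  inner : {dot H for @idfun R} ;
  inner_norm : forall x : H, inner x x = `|x| ^+ 2
}.

#[short(type=hilbertType)]
HB.structure Definition Hilbert (R : realType) :=
  {H of CompleteNormedModule_isHilbert R H & CompleteNormedModule R H}.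

Definition monotone_operator (R : realType) (H : hilbertType R)
    (f : H -> H) : Prop :=
  forall x y, 0 <= inner (f x - f y) (x - y).

Definition bounded_operator (R : realType) (H : hilbertType R)
    (D : {linear H -> H}) : Prop :=
  exists M : R, forall x, `|D x| <= M * `|x|.

(* Empty at the points outside [K]. *)
Definition normal_cone (R : realType) (H : hilbertType R)
    (K : set H) (x : H) : set H :=
  [set u | K x /\ forall y, K y -> inner u (y - x) <= 0].

Definition set_valued_inv (X Y : Type) (F : X -> set Y) (y : Y) : set X :=
  [set x | F x y].

(* Main.v *)
Require Import Defs.
From mathcomp Require Import all_boot all_order all_algebra.
From mathcomp Require Import all_classical all_reals all_analysis.
Import Order.TTheory GRing.Theory Num.Theory.
Import numFieldNormedType.Exports.

Local Open Scope classical_set_scope.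
Local Open Scope ring_scope.

(** Both inclusions say that $-f(x) \in N_\Omega(x + Df(x))$. On the left, [zero_in_translate] gives
    $x = u + D(-f(x))$ with $-f(x) \in N_\Omega(u)$, and linearity of $D$ forces $u = x + Df(x)$. On
    the right, $K(x)$ is a translate of $\Omega$, so [normal_cone_translate] moves the base point
    from $x$ to $x + Df(x)$. *)

Lemma normal_cone_translate (R : realType) (H : hilbertType R) (K : set H)
    (a x : H) :
  normal_cone [set w - a | w in K] x = normal_cone K (x + a).
Proof.
apply/seteqP; split=> u /=.
- move=> [[w Kw xE] le0]; split=> [|y Ky]; first by rewrite -xE subrK.
  (* Only differences of points enter: $y - (x + a) = (y - a) - x$, with $y - a$ in the
     translate. *)
  by rewrite opprD addrCA addrC; apply: le0; exists y.
- move=> [Kxa le0]; split; first by exists (x + a); rewrite ?addrK.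
  by move=> _ [w Kw <-]; have := le0 w Kw; rewrite opprD addrCA addrC.
Qed.

Lemma zero_in_translate (V : zmodType) (a : V) (A : set V) :
  0 \in [set a + u | u in A] <-> A (- a).
Proof.
split=> [/set_mem [u Au /eqP]|Aa].
  by rewrite addrC addr_eq0 => /eqP <-.
by apply/mem_set; exists (- a); rewrite ?subrr.
Qed.

Theorem proposition10 (R : realType) (H : hilbertType R)
    (f : H -> H) (D : {linear H -> H}) (Omega : set H) :
  monotone_operator f -> lipschitz f ->
  bounded_operator D ->
  Omega !=set0 -> closed Omega -> convex_set Omega ->
  let K (x : H) : set H := [set w - D (f x) | w in Omega] in
  let NinvD (y : H) : set H :=
    [set u + D y | u in set_valued_inv (normal_cone Omega) y] in
  forall x : H,
    0 \in [set f x + u | u in set_valued_inv NinvD x] <->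
    0 \in [set f x + u | u in normal_cone (K x) x].
Proof.
move=> _ _ _ _ _ _ K NinvD x.
rewrite !zero_in_translate normal_cone_translate /set_valued_inv /NinvD /=.
rewrite linearN; split=> [[u Nu uE]|Nx].
  (* Only the base point is rewritten, to $u$; the $x$ inside [f x] must stay. *)
  by rewrite -{1}uE subrK.
(* The witness solves $u - Df(x) = x$. *)
by exists (x + D (f x)); rewrite ?addrK.
Qed.
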